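(* Let $\mathbf d=(d_1,\dots,d_n)$ be a point with positive integer coordinates, let $d=\operatorname{lcm}(d_1,\dots,d_n)$, and let $\mathfrak d=\langle x_1^{d_1},\dots,x_n^{d_n}\rangle\subset R$. Suppose $p>nd-n$ and $p\nmid d$, and let $\mathbf u\in\mathbb N^n$ satisfy $0<u_i\le d_i$ for all $i$. (1) If $\deg(\mathbf u)>d$, then $\operatorname{crit}(\mathfrak d,\mathbf u)=1$. (2) Otherwise, if $s=\inf\{e\ge1:\|[p^e\bar{\mathbf u}\,\%\,d]\|>d\}$, then $$\operatorname{crit}(\mathfrak d,\mathbf u)=\frac{\deg(\mathbf u)}{d}-\frac{\|[p^s\bar{\mathbf u}\,\%\,d]\|-d}{d\,p^s},$$ which is interpreted to agree with $\deg(\mathbf u)/d$ if $s=\infty$.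
   Context: $p$ is a prime, $\Bbbk$ is a field of characteristic $p$ with $[\Bbbk:\Bbbk^p]<\infty$, $n\ge1$, $R=\Bbbk[x_1,\dots,x_n]$. For integers $m$ and $d\ge1$, $[m\,\%\,d]$ is the least positive residue of $m$ modulo $d$ (an element of $\{1,\dots,d\}$); for $\mathbf v\in\mathbb Z^n$, $[\mathbf v\,\%\,d]=([v_1\,\%\,d],\dots,[v_n\,\%\,d])$. For $\mathbf v\in\mathbb N^n$, $\|\mathbf v\|=v_1+\cdots+v_n$. For $\mathbf u\in\mathbb N^n$, $\bar{\mathbf u}=(du_1/d_1,\dots,du_n/d_n)\in\mathbb N^n$ and $\deg(\mathbf u)=\|\bar{\mathbf u}\|=\sum_i du_i/d_i$ (the degree of $x^{\mathbf u}$ in the grading with $\deg(x_i)=d/d_i$). For $\mathbf u\in\mathbb N^n$ with positive coordinates, $\operatorname{diag}(\mathbf u)=\langle x_1^{u_1},\dots,x_n^{u_n}\rangle$. For an ideal $\mathfrak b$ and $e\ge0$, $\mathfrak b^{[p^e]}=\langle f^{p^e}:f\in\mathfrak b\rangle$. If $m\in\mathbb N$ has base $p$ expansion $m=m_0+m_1p+\cdots+m_rp^r$, the Frobenius power is $\mathfrak a^{[m]}=\mathfrak a^{m_0}(\mathfrak a^{m_1})^{[p]}\cdots(\mathfrak a^{m_r})^{[p^r]}$. For a nonzero proper ideal $\mathfrak a$ and a proper ideal $\mathfrak b$ with $\mathfrak a\subseteq\sqrt{\mathfrak b}$, and $q=p^e$, $\mu(\mathfrak a,\mathfrak b,q)=\max\{m\in\mathbb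 N:\mathfrak a^{[m]}\not\subseteq\mathfrak b^{[q]}\}$ and $\operatorname{crit}(\mathfrak a,\mathfrak b)=\lim_{q\to\infty}\mu(\mathfrak a,\mathfrak b,q)/q$ (the limit exists). We write $\operatorname{crit}(\mathfrak a,\mathbf u)$ for $\operatorname{crit}(\mathfrak a,\operatorname{diag}(\mathbf u))$. *)

(* Defs.v *)
From HB Require Import structures.
From mathcomp Require Import all_boot all_order all_algebra.
From mathcomp Require Import boolp classical_sets functions reals topology normedtype sequences.
From mathcomp Require Import -(notations) mpoly.

Set Implicit Arguments.
Unset Strict Implicit.
Unset Printing Implicit Defensive.

Import Order.TTheory GRing.Theory Num.Theory.
Import numFieldNormedType.Exports.

Local Open Scope classical_set_scope.
Local Open Scope ring_scope.

(* [mpoly] is imported without its notations, which clash with those of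
   MathComp-Analysis: [mpoly n k] is {mpoly k[n]}, and [mpolyX k (mnm1 i)] is
   the variable 'X_i. *)

(* Ideals are represented as classical sets: the boolean [idealr] predicates of
   MathComp are proper by definition, whereas [a^0] has to be the unit ideal. *)
Definition is_ideal (A : comNzRingType) (I : set A) : Prop :=
  [/\ I 0, forall x y, I x -> I y -> I (x + y) & forall a x, I x -> I (a * x)].

Definition ideal_gen (A : comNzRingType) (G : set A) : set A :=
  smallest (@is_ideal A) G.

Definition ideal_mul (A : comNzRingType) (I J : set A) : set A :=
  ideal_gen [set x * y | x in I & y in J].

Definition ideal_exp (A : comNzRingType) (I : set A) (m : nat) : set A :=
  iter m (ideal_mul I) setT.

(* [frob_pow p I e] is I^[p^e]. *)
Definition frob_pow (A : comNzRingType) (p : nat) (I : set A) (e : nat) : set A :=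
  ideal_gen [set f ^+ (p ^ e)%N | f in I].

(* I^[m] for arbitrary m; the i-th base p digit of m is [m %/ p ^ i %% p]. *)
Definition gen_frob_pow (A : comNzRingType) (p : nat) (I : set A) (m : nat) :
    set A :=
  \big[@ideal_mul A/setT]_(i < (trunc_log p m).+1)
    frob_pow p (ideal_exp I (m %/ p ^ i %% p)%N) i.

(* [mu p I J e] is mu(I, J, p ^ e); it is 0 when there is no maximum. *)
Definition mu (A : comNzRingType) (p : nat) (I J : set A) (e : nat) : nat :=
  let S := [set m | ~ (gen_frob_pow p I m `<=` frob_pow p J e)] in
  xget 0%N [set m | S m /\ forall m', S m' -> (m' <= m)%N].

(* [limn] is 0 for a divergent sequence. *)
Definition crit (R : realType) (A : comNzRingType) (p : nat) (I J : set A) : R :=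
  limn (fun e : nat => (mu p I J e)%:R / (p ^ e)%N%:R : R).

(* [k : k^p] is finite: k is spanned by finitely many elements over k^p. *)
Definition F_finite (p : nat) (k : fieldType) : Prop :=
  exists (m : nat) (b : 'I_m -> k),
    forall x : k, exists c : 'I_m -> k, x = \sum_i c i ^+ p * b i.

Definition diag_ideal (k : fieldType) (n : nat) (u : 'I_n -> nat) :
    set (mpoly n k) :=
  ideal_gen (range (fun i : 'I_n => mpolyX k (mnm1 i) ^+ u i)).

Arguments diag_ideal k {n} u.

Definition lcm_coords (n : nat) (d : 'I_n -> nat) : nat :=
  \big[lcmn/1%N]_(i < n) d i.

(* The division is exact, since d_i divides the lcm. *)
Definition bar (n : nat) (d u : 'I_n -> nat) (i : 'I_n) : nat :=
  (lcm_coords d * u i %/ d i)%N.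

Definition norm1 (n : nat) (v : 'I_n -> nat) : nat := (\sum_(i < n) v i)%N.

Definition wdeg (n : nat) (d u : 'I_n -> nat) : nat := norm1 (bar d u).

(* Least positive residue, with values in {1, ..., d}. *)
Definition lpr (m d : nat) : nat := if (d %| m)%N then d else (m %% d)%N.

(* || [p^e ubar % d] || *)
Definition norm_res (p n : nat) (d u : 'I_n -> nat) (e : nat) : nat :=
  norm1 (fun i => lpr (p ^ e * bar d u i) (lcm_coords d)).

(* Main.v *)
(* Monomial ideals are closed under products and, in characteristic p, under
   Frobenius powers; hence d^[m] is generated by the monomials x^(d v) such that
   the v_j add up to m without carry in base p. So mu(p^e) is the largest carry
   free sum of numbers v_j <= N_j(p^e), where N_j(p^e) is one less than the
   ceiling of p^e u_j / d_j; its base p digits are the first e digits of the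
   non-terminating expansion of u_j / d_j. The sum of the digits at place e + 1
   is (p |[p^e ubar % D]| - |[p^(e+1) ubar % D]|) / D: it is less than p as long as
   |[p^e ubar % D]| <= D, and at least p right after the first e = s >= 0 where this
   fails, unless some u_j = d_j, in which case all digits of u_j / d_j are p - 1.
   Up to that place all digits are taken, and beyond it a carry free sum can have
   all its digits equal to p - 1, so that
   mu(p^e) = (sum_j N_j(p^s) + 1) p^(e-s) - 1 for e >= s. *)
Require Import Defs.
From HB Require Import structures.
From mathcomp Require Import all_boot all_order all_algebra.
From mathcomp Require Import boolp classical_sets functions reals topology normedtype sequences.
From mathcomp Require Import -(notations) mpoly.
From mathcomp Require Import zify ring.

Set Implicit Arguments.
Unset Strict Implicit.
Unset Printing Implicit Defensive.

Import Order.TTheory GRing.Theory Num.Theory.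
Import numFieldNormedType.Exports.

Local Open Scope ring_scope.

(** * Generated ideals *)

Section Ideals.
Context (A : comNzRingType).
Implicit Types (I G : set A).
Local Open Scope classical_set_scope.

Lemma ideal_gen_ideal G : is_ideal (ideal_gen G).
Proof.
split=> [I [[I0 _ _] _] | x y Gx Gy I [II GI] | a x Gx I [II GI]] //.
- by case: (II) => _ + _; apply; [apply: Gx | apply: Gy].
- by case: (II) => _ _; apply; apply: Gx.
Qed.

Lemma ideal_gen_sub G I : is_ideal I -> G `<=` I -> ideal_gen G `<=` I.
Proof. by move=> II GI x; apply. Qed.

Lemma sub_ideal_gen G : G `<=` ideal_gen G.
Proof. by move=> x Gx I [_]; apply. Qed.

End Ideals.

(** * Monomial ideals, their products and Frobenius powers *)

Section MonomialIdeals.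
Context (k : fieldType) (n : nat).
Implicit Types (V W : set (multinom n)) (v w m : multinom n).
Local Open Scope classical_set_scope.

(** The ideal generated by the x^v with v in [V], described through supports so that inclusions
    become comparisons of exponents. *)
Definition mon_ideal V : set (mpoly n k) :=
  [set f | forall m, m \in msupp f -> exists2 v, V v & forall j, (v j <= m j)%N].

Lemma mon_ideal_ideal V : is_ideal (mon_ideal V).
Proof.
split=> [m | f g Vf Vg m | f g Vg m].
- by rewrite msupp0.
- move/msuppD_le; rewrite mem_cat => /orP[]; [exact: Vf | exact: Vg].
- move/msuppM_le/allpairsP => [[m1 m2] /= [_ /Vg[v Vv vm] ->]].
  by exists v => // j; rewrite mnmDE; apply: leq_trans (leq_addl _ _).
Qed.

Lemma mon_idealX V w :
  mon_ideal V (mpolyX k w) <-> exists2 v, V v & forall j, (v j <= w j)%N.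
Proof.
split=> [|Vw m]; first by apply; rewrite msuppX mem_seq1.
by rewrite msuppX mem_seq1 => /eqP->.
Qed.

Lemma mem_mon_ideal V w : V w -> mon_ideal V (mpolyX k w).
Proof. by move=> Vw; apply/mon_idealX; exists w. Qed.

(** Every term of f is a multiple of some x^v with v in [V]. *)
Lemma mon_ideal_min V (I : set (mpoly n k)) :
  is_ideal I -> (forall v, V v -> I (mpolyX k v)) -> mon_ideal V `<=` I.
Proof.
move=> II VI f Vf; rewrite (mpolyE f) big_seq.
have [I0 ID IM] := II; apply: (big_ind I) => // m /Vf[v Vv vm].
have -> : m = mnm_add (mnm_sub m v) v.
  by apply/mnmP=> j; rewrite mnmDE mnmBE subnK.
by rewrite -mul_mpolyC mpolyXD mulrA; apply: IM; apply: VI.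
Qed.

Lemma mon_ideal_sub V W :
  (forall v, V v -> exists2 w, W w & forall j, (w j <= v j)%N) ->
  mon_ideal V `<=` mon_ideal W.
Proof.
move=> VW; apply: mon_ideal_min; first exact: mon_ideal_ideal.
by move=> v /VW; rewrite -mon_idealX.
Qed.

Lemma mon_ideal1 : setT = mon_ideal [set @mnm0 n].
Proof.
apply/seteqP; split=> // f _ m _; exists mnm0 => // j.
by rewrite mnm0E.
Qed.

Lemma diag_idealE (w : 'I_n -> nat) :
  diag_ideal k w = mon_ideal (range (fun i => mnm_muln (mnm1 i) (w i))).
Proof.
apply/seteqP; split.
  apply: ideal_gen_sub; first exact: mon_ideal_ideal.
  by move=> _ [i _ <-]; rewrite mpolyXn; apply: mem_mon_ideal; exists i.
apply: mon_ideal_min; first exact: ideal_gen_ideal.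
by move=> _ [i _ <-]; rewrite -mpolyXn; apply: sub_ideal_gen; exists i.
Qed.

Lemma ideal_mul_mon V W :
  ideal_mul (mon_ideal V) (mon_ideal W) =
  mon_ideal [set mnm_add v w | v in V & w in W].
Proof.
apply/seteqP; split.
  apply: ideal_gen_sub; first exact: mon_ideal_ideal.
  move=> _ [f Vf [g Wg <-]] m /msuppM_le/allpairsP[[m1 m2] /=].
  case=> /Vf[v Vv vm] /Wg[w Ww wm] ->.
  exists (mnm_add v w); first by exists v => //; exists w.
  by move=> j; rewrite !mnmDE leq_add.
apply: mon_ideal_min; first exact: ideal_gen_ideal.
move=> _ [v Vv [w Ww <-]]; rewrite mpolyXD; apply: sub_ideal_gen.
by exists (mpolyX k v); [|exists (mpolyX k w)]; try exact: mem_mon_ideal.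
Qed.

Lemma frob_pow_mon p V e : p \in [pchar k] ->
  frob_pow p (mon_ideal V) e = mon_ideal [set mnm_muln v (p ^ e) | v in V].
Proof.
move=> hp.
have charq : [pchar mpoly n k].-nat (p ^ e)%N.
  rewrite pnatX (pi_pnat _ (rmorph_pchar (@mpolyC n k) hp)) //.
  by rewrite pnat_id // (pcharf_prime hp).
have [M0 MD MM] := mon_ideal_ideal [set mnm_muln v (p ^ e) | v in V].
apply/seteqP; split.
  apply: ideal_gen_sub; first exact: mon_ideal_ideal.
  (* Frobenius being additive, the f whose q-th power lies in an ideal form an
     ideal. *)
  move=> _ [f Vf <-]; move: f Vf.
  apply: (mon_ideal_min (I := [set f | mon_ideal _ (f ^+ _)])).
    split=> /= [|f g Mf Mg|f g Mg].
    - by rewrite expr0n expn_eq0 eqn0Ngt prime_gt0 ?(pcharf_prime hp).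
    - by rewrite exprDn_pchar //; apply: MD.
    - by rewrite exprMn; apply: MM.
  by move=> v Vv /=; rewrite mpolyXn; apply: mem_mon_ideal; exists v.
apply: mon_ideal_min; first exact: ideal_gen_ideal.
move=> _ [v Vv <-]; rewrite -mpolyXn; apply: sub_ideal_gen.
by exists (mpolyX k v) => //; apply: mem_mon_ideal.
Qed.

End MonomialIdeals.

Arguments mon_ideal k {n} V.

(** * Carry-free sums in base p *)

Section NoCarry.
Local Open Scope nat_scope.
Context (p n : nat).
Implicit Types (m : nat) (v c : 'I_n -> nat).

(* Comparing floors at every place p ^ i says that m is the sum of the v j and
   that this addition in base p involves no carry. *)
Definition nocarry m v := forall i, m %/ p ^ i = \sum_j v j %/ p ^ i.

Lemma nocarry_sum m v : nocarry m v -> m = \sum_j v j.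
Proof.
by move/(_ 0); rewrite divn1 => ->; apply: eq_bigr => j _; rewrite divn1.
Qed.

Lemma nocarry0 m v : m = 0 -> (forall j, v j = 0) -> nocarry m v.
Proof. by move=> -> v0 i; rewrite div0n big1 // => j _; rewrite v0 div0n. Qed.

(** Appends a lowest digit to each summand: as the new digits add up to less than p, dividing by p ^
    i.+1 discards them on both sides. *)
Lemma nocarry_cons m v c : \sum_j c j < p -> nocarry m v ->
  nocarry (p * m + \sum_j c j) (fun j => p * v j + c j).
Proof.
move=> ltcp mv [|i].
  rewrite divn1 (nocarry_sum mv) big_distrr -big_split /=.
  by apply: eq_bigr => j _; rewrite divn1.
have p_gt0 : 0 < p by apply: leq_ltn_trans ltcp.
have shift a b : b < p -> (p * a + b) %/ p ^ i.+1 = a %/ p ^ i.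
  by move=> bp; rewrite expnS divnMA mulnC divnMDl // (divn_small bp) addn0.
rewrite shift // mv; apply: eq_bigr => j _; rewrite shift //.
by apply: leq_ltn_trans ltcp; rewrite (bigD1 j) //= leq_addr.
Qed.

Lemma nocarry_div m v : nocarry m v -> nocarry (m %/ p) (fun j => v j %/ p).
Proof.
move=> mv i; rewrite -divnMA -expnS mv; apply: eq_bigr => j _.
by rewrite expnS divnMA.
Qed.

Lemma nocarry_mod m v : nocarry m v -> m %% p = \sum_j v j %% p.
Proof.
move=> mv; have := nocarry_sum mv.
rewrite {1}(divn_eq m p) (eq_bigr _ (fun j _ => divn_eq (v j) p)) big_split /=.
rewrite -big_distrl /=.
have /nocarry_sum -> := nocarry_div mv.
by move/addnI.
Qed.

End NoCarry.

(** * Frobenius powers of diagonal ideals, and mu as a largest carry-free sum *)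

Section DiagonalIdeals.
Context (k : fieldType) (n : nat) (d : 'I_n -> nat).
Implicit Types (P Q : ('I_n -> nat) -> Prop).
Local Open Scope classical_set_scope.

(** Exponents of monomials in the powers x_j^(d_j); for the ideals built from the diagonal one, only
    the condition [P] on c has to be tracked. *)
Definition scaled P : set (multinom n) :=
  [set v | exists2 c, P c & forall j, v j = (d j * c j)%N].

Lemma scaled_mnm P c : P c -> exists2 v, scaled P v & forall j, v j = (d j * c j)%N.
Proof.
move=> Pc; exists (Multinom [tuple (d i * c i)%N | i < n]).
  by exists c => // j; rewrite mnmE.
by move=> j; rewrite mnmE.
Qed.

Lemma mon_scaled_ext P (V : set (multinom n)) :
  (forall c, P c -> exists2 v, V v & forall j, v j = (d j * c j)%N) ->
  (V `<=` scaled P) -> mon_ideal k V = mon_ideal k (scaled P).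
Proof.
move=> PV VP; apply/seteqP; split; apply: mon_ideal_sub => v.
  by move=> /VP; exists v.
by move=> [c /PV[w Vw wc] vc]; exists w => // j; rewrite wc vc.
Qed.

Lemma ideal_mul_scaled P Q :
  ideal_mul (mon_ideal k (scaled P)) (mon_ideal k (scaled Q)) =
  mon_ideal k (scaled (fun c => exists a b,
    [/\ P a, Q b & forall j, c j = (a j + b j)%N])).
Proof.
rewrite ideal_mul_mon; apply: mon_scaled_ext => [c [a [b [Pa Qb cE]]] | v].
  have [[v Pv va] [w Qw wb]] := (scaled_mnm Pa, scaled_mnm Qb).
  exists (mnm_add v w); first by exists v => //; exists w.
  by move=> j; rewrite mnmDE va wb cE mulnDr.
move=> [x [a Pa xa] [y [b Qb yb] <-]].
exists (fun j => (a j + b j)%N); first by exists a, b.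
by move=> j; rewrite mnmDE xa yb mulnDr.
Qed.

Lemma scaled_diag :
  diag_ideal k d = mon_ideal k (scaled (fun c => exists i, forall j, c j = (i == j))).
Proof.
rewrite diag_idealE; apply: mon_scaled_ext => [c [i ci]|v [i _ <-]].
  exists (mnm_muln (mnm1 i) (d i)); first by exists i.
  move=> j; rewrite mulmnE mnm1E ci.
  by case: eqP => [->|]; rewrite ?muln0 ?muln1 ?mul1n.
exists (fun j => i == j : nat); first by exists i.
by move=> j; rewrite mulmnE mnm1E; case: eqP => [->|]; rewrite ?muln0 ?muln1 ?mul1n.
Qed.

Lemma scaled_setT : setT = mon_ideal k (scaled (fun c => forall j, c j = 0%N)).
Proof.
rewrite mon_ideal1; apply: mon_scaled_ext => [c c0|v ->].
  by exists mnm0 => // j; rewrite mnm0E c0 muln0.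
by exists (fun=> 0%N) => // j; rewrite mnm0E muln0.
Qed.

Lemma eq_scaled P Q : (forall c, P c <-> Q c) -> scaled P = scaled Q.
Proof. by move=> PQ; congr scaled; apply/funext => c; apply/propext. Qed.

Lemma scaled_exp a :
  ideal_exp (diag_ideal k d) a = mon_ideal k (scaled (fun c => a = \sum_j c j)%N).
Proof.
elim: a => [|a IHa].
  rewrite /ideal_exp /= scaled_setT; congr mon_ideal; apply: eq_scaled => c.
  split=> [c0|c0 j]; first by rewrite big1.
  by apply/eqP; rewrite -leqn0 c0 (bigD1 j) //= leq_addr.
rewrite [LHS]/= -/(ideal_exp _ _) IHa scaled_diag ideal_mul_scaled.
congr mon_ideal; apply: eq_scaled => c; split.
  move=> [x [y [[i xi] ya cE]]]; under eq_bigr do rewrite cE.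
  rewrite big_split /= -ya (bigD1 i) //= xi eqxx big1 // => j.
  by rewrite xi eq_sym => /negPf->.
(* A positive sum has a positive term c_i, so one factor x_i^(d_i) can be split off. *)
move=> ca; have [i ci] : exists i, (0 < c i)%N.
  apply/existsP; apply: contra_eqT ca; rewrite negb_exists => /forallP c0.
  by rewrite big1 // => j _; apply/eqP; rewrite -leqn0 leqNgt c0.
exists (fun j => i == j : nat), (fun j => c j - (i == j))%N; split.
- by exists i.
- apply: succn_inj; rewrite ca (bigD1 i) //= [in RHS](bigD1 i) //= eqxx.
  rewrite -addSn subn1 prednK //; congr addn; apply: eq_bigr => j.
  by rewrite eq_sym => /negPf->; rewrite subn0.
- by move=> j; case: eqP => [<-|_]; rewrite ?subnKC.
Qed.

Lemma frob_pow_scaled p P e : p \in [pchar k] ->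
  frob_pow p (mon_ideal k (scaled P)) e =
  mon_ideal k (scaled (fun c => exists2 a, P a & forall j, c j = (p ^ e * a j)%N)).
Proof.
move=> hp; rewrite frob_pow_mon //; apply: mon_scaled_ext => [c [a Pa ca]|].
  have [v Pv va] := scaled_mnm Pa; exists (mnm_muln v (p ^ e)); first by exists v.
  by move=> j; rewrite mulmnE va ca mulnCA mulnC mulnA.
move=> _ [v [a Pa va] <-]; exists (fun j => p ^ e * a j)%N; first by exists a.
by move=> j; rewrite mulmnE va mulnCA mulnC mulnA.
Qed.

Lemma gen_frob_pow_diag p m : p \in [pchar k] ->
  gen_frob_pow p (diag_ideal k d) m = mon_ideal k (scaled (nocarry p m)).
Proof.
move=> hp; have p_gt1 := prime_gt1 (pcharf_prime hp).
have p_gt0 := ltnW p_gt1.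
(* Induction on the number of digits: peeling off the lowest one turns m' into m' / p and raises all
   Frobenius exponents by one, whence the shift t. *)
have digits L t m' : (m' < p ^ L)%N ->
  \big[@ideal_mul _/setT]_(i < L)
     frob_pow p (ideal_exp (diag_ideal k d) (m' %/ p ^ i %% p)%N) (t + i) =
  mon_ideal k (scaled (fun c => exists2 v, nocarry p m' v &
                                 forall j, c j = (p ^ t * v j)%N)).
  elim: L t m' => [|L IHL] t m' ltm.
    rewrite big_ord0 scaled_setT; congr mon_ideal; apply: eq_scaled => c.
    have m0 : m' = 0%N by case: m' ltm.
    split=> [c0|[v mv cv] j].
      by exists (fun=> 0%N) => [|j]; [exact: nocarry0 | rewrite c0 muln0].
    rewrite cv; move: (nocarry_sum mv); rewrite (bigD1 j) //= m0 => /esym/eqP.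
    by rewrite addn_eq0 => /andP[/eqP-> _]; rewrite muln0.
  have ltm' : (m' %/ p < p ^ L)%N by rewrite ltn_divLR // mulnC -expnS.
  rewrite big_ord_recl /= expn0 divn1 addn0 scaled_exp frob_pow_scaled //.
  under eq_bigr => i _ do rewrite /bump /= add1n expnS divnMA addnS -addSn.
  rewrite IHL // ideal_mul_scaled; congr mon_ideal; apply: eq_scaled => c; split.
    move=> [a [b [[a' sa' aE] [b' mb' bE] cE]]].
    exists (fun j => p * b' j + a' j)%N => [|j].
      rewrite (divn_eq m' p) mulnC sa'; apply: nocarry_cons => //.
      by rewrite -sa' ltn_mod.
    by rewrite cE aE bE expnSr mulnDr mulnA addnC.
  move=> [v mv cE].
  exists (fun j => p ^ t * (v j %% p))%N, (fun j => p ^ t.+1 * (v j %/ p))%N; split.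
  - by exists (fun j => v j %% p)%N => //; apply: nocarry_mod.
  - by exists (fun j => v j %/ p)%N => //; apply: nocarry_div.
  - by move=> j; rewrite cE expnSr -mulnA -mulnDr addnC mulnC (mulnC p) -divn_eq mulnC.
rewrite /gen_frob_pow (digits _ 0%N) ?trunc_log_ltn //.
congr mon_ideal; apply: eq_scaled => c; split=> [[v mv cv]|mc].
  by move=> i; rewrite mv; apply: eq_bigr => j _; rewrite cv mul1n.
by exists c => // j; rewrite mul1n.
Qed.

(** Both sides are monomial ideals, and a monomial avoids the right one exactly when each exponent
    stays below p^e u_j. *)
Lemma gen_frob_pow_sub_diag p m (u : 'I_n -> nat) e : p \in [pchar k] ->
  ~ (gen_frob_pow p (diag_ideal k d) m `<=` frob_pow p (diag_ideal k u) e) <->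
  exists2 v, nocarry p m v & forall j, (d j * v j < p ^ e * u j)%N.
Proof.
move=> hp; rewrite gen_frob_pow_diag // diag_idealE frob_pow_mon //; split.
  apply: contra_notP => nov; apply: mon_ideal_sub => w [v mv wv].
  have [j lej] : exists j, (p ^ e * u j <= d j * v j)%N.
    apply: contra_notP nov => nolej; exists v => // j; rewrite ltnNge.
    by apply/negP => lej; apply: nolej; exists j.
  exists (mnm_muln (mnm_muln (mnm1 j) (u j)) (p ^ e)).
    by exists (mnm_muln (mnm1 j) (u j)) => //; exists j.
  move=> i; rewrite !mulmnE mnm1E wv.
  by case: eqP => [<-|]; rewrite ?mul0n // mul1n mulnC.
move=> [v mv lev] sub; have [w mw wv] := scaled_mnm mv.
have /mon_idealX[_ [_ [i _ <-] <-]] := sub _ (mem_mon_ideal mw).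
move/(_ i); rewrite !mulmnE mnm1E eqxx mul1n mulnC wv.
by rewrite leqNgt lev.
Qed.

(** An attained upper bound is the unique maximum, so the default value 0 of [xget] does not
    interfere. *)
Lemma mu_diag p (u : 'I_n -> nat) e m v : p \in [pchar k] ->
  nocarry p m v -> (forall j, d j * v j < p ^ e * u j)%N ->
  (forall m' v', nocarry p m' v' -> (forall j, d j * v' j < p ^ e * u j)%N ->
    m' <= m)%N ->
  mu p (diag_ideal k d) (diag_ideal k u) e = m.
Proof.
move=> hp mv ltv maxm; apply: xget_unique.
  split; first by apply/gen_frob_pow_sub_diag => //; exists v.
  by move=> m' /gen_frob_pow_sub_diag-/(_ hp)[v' mv' ltv']; apply: maxm ltv'.
move=> m' [/gen_frob_pow_sub_diag-/(_ hp)[v' mv' ltv'] maxm'].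
apply/eqP; rewrite eqn_leq (maxm _ v') //=; apply: maxm'.
by apply/gen_frob_pow_sub_diag => //; exists v.
Qed.

End DiagonalIdeals.

(** * Truncated base p expansions of the fractions w_j / D *)

Section TruncatedExpansions.
Local Open Scope nat_scope.
Context (p n D : nat) (w : 'I_n -> nat).
Hypotheses (p_prime : prime p) (n_gt0 : 0 < n) (D_gt0 : 0 < D).
Hypothesis wD : forall j, 0 < w j <= D.
Implicit Types (v : 'I_n -> nat).

Definition res e (j : 'I_n) := lpr (p ^ e * w j) D.
(* The ceiling of p ^ e * w j / D, minus one. *)
Definition trunc e (j : 'I_n) := (p ^ e * w j).-1 %/ D.

Let p_gt0 : 0 < p. Proof. exact: prime_gt0. Qed.

Lemma lpr_bounds x : 0 < lpr x D <= D.
Proof.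
rewrite /lpr; case: ifPn => [_|Dx]; first by rewrite D_gt0 leqnn.
by rewrite lt0n Dx ltnW ?ltn_mod.
Qed.

(** Division with remainder in 1, ..., D: the quotient is then that of x - 1. *)
Lemma lprE x : 0 < x -> x = D * (x.-1 %/ D) + lpr x D.
Proof.
case: x => // x _ /=; rewrite /lpr; case: ifPn => [/dvdnP[q xq]|Dx].
  case: q xq => // q; rewrite mulSn => xq.
  have -> : x = q * D + D.-1 by lia.
  by rewrite divnMDl // divn_small ?addn0 ?prednK //; lia.
have ltD : (x %% D).+1 < D.
  rewrite ltn_neqAle ltn_mod D_gt0 andbT; apply: contra Dx => /eqP modx.
  by rewrite (divn_eq x D) -addnS modx -mulSnr dvdn_mull.
rewrite {1}(divn_eq x.+1 D) mulnC; congr (_ * _ + _).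
by rewrite {1}(divn_eq x D) -addnS divnMDl // (divn_small ltD) addn0.
Qed.

Lemma ltn_trunc e j x : (D * x < p ^ e * w j) = (x <= trunc e j).
Proof.
have [w_gt0 _] := andP (wD j).
have : 0 < p ^ e * w j by rewrite muln_gt0 expn_gt0 p_gt0.
rewrite /trunc; case: (p ^ e * w j) => // y _ /=.
by rewrite ltnS mulnC leq_divRL.
Qed.

Lemma trunc0 j : trunc 0 j = 0.
Proof. by rewrite /trunc mul1n divn_small // prednK; case/andP: (wD j). Qed.

Lemma sum_trunc0 : \sum_j trunc 0 j = 0.
Proof. by apply: big1 => j _; apply: trunc0. Qed.

Lemma trunc_res e j : p ^ e * w j = D * trunc e j + res e j.
Proof.
by apply: lprE; have [w_gt0 _] := andP (wD j); rewrite muln_gt0 expn_gt0 p_gt0.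
Qed.

Lemma sum_trunc_res e :
  p ^ e * (\sum_j w j) = D * (\sum_j trunc e j) + \sum_j res e j.
Proof.
by rewrite !big_distrr -big_split /=; apply: eq_bigr => j _; apply: trunc_res.
Qed.

Lemma leq_trunc_mulp e j : p * trunc e j <= trunc e.+1 j.
Proof.
by rewrite -ltn_trunc mulnCA expnS -mulnA ltn_pmul2l // ltn_trunc.
Qed.

(** Digit at place e + 1 of the non-terminating expansion of w_j / D; the subtraction is exact by
    [leq_trunc_mulp]. *)
Definition digit e (j : 'I_n) := trunc e.+1 j - p * trunc e j.

Lemma digitE e j : trunc e.+1 j = p * trunc e j + digit e j.
Proof. by rewrite subnKC // leq_trunc_mulp. Qed.

(** One step of long division, p * res e j = D * digit e j + res e.+1 j, summed over j. *)
Lemma sum_digit e :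
  D * (\sum_j digit e j) + \sum_j res e.+1 j = p * (\sum_j res e j).
Proof.
rewrite !big_distrr -big_split /=; apply: eq_bigr => j _.
have := trunc_res e.+1 j; rewrite digitE expnS -mulnA trunc_res; nia.
Qed.

Lemma sum_res_bounds e : n <= \sum_j res e j <= n * D.
Proof.
have sum_const a : n * a = \sum_(j < n) a by rewrite sum_nat_const card_ord.
rewrite -{1}[n]muln1 !sum_const; apply/andP; split; apply: leq_sum => j _.
  by case/andP: (lpr_bounds (p ^ e * w j)).
by case/andP: (lpr_bounds (p ^ e * w j)).
Qed.

(** If the residues at e' add up to at most D, then D times the next digit sum is at most p D - n <
    p D, so that place has no carry. *)
Lemma nocarry_trunc e :
  (forall e', e' < e -> \sum_j res e' j <= D) ->
  nocarry p (\sum_j trunc e j) (trunc e).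
Proof.
elim: e => [|e IHe] small.
  by apply: nocarry0 => [|j]; rewrite ?sum_trunc0 ?trunc0.
have -> : trunc e.+1 = fun j => p * trunc e j + digit e j.
  by apply/funext => j; apply: digitE.
rewrite big_split -big_distrr; apply: nocarry_cons; last first.
  by apply: IHe => e' ltee'; apply: small; apply: ltnW.
have := sum_digit e; have := small e (ltnSn _); have := sum_res_bounds e.+1.
by set x := \sum_j digit e j; nia.
Qed.

(** Without carry, the floor of m / p^(e-s) is the sum of the floors of v_j / p^(e-s), and each of
    these is at most [trunc s j]. *)
Lemma nocarry_bound s e m v : s <= e -> nocarry p m v ->
  (forall j, D * v j < p ^ e * w j) ->
  m < (\sum_j trunc s j).+1 * p ^ (e - s).
Proof.
move=> les mv ltv; rewrite -ltn_divLR ?expn_gt0 ?p_gt0 // ltnS mv.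
apply: leq_sum => j _; rewrite -ltn_trunc.
have q_gt0 : 0 < p ^ (e - s) by rewrite expn_gt0 p_gt0.
rewrite -(ltn_pmul2r q_gt0); apply: leq_ltn_trans (_ : D * v j < _).
  by rewrite -mulnA leq_mul2l leq_divM orbT.
by rewrite mulnAC -expnD subnKC.
Qed.

Lemma sum_lower_bound (g : 'I_n -> nat) a : a <= \sum_j g j ->
  exists2 c : 'I_n -> nat, \sum_j c j = a & forall j, c j <= g j.
Proof.
elim: a => [|a IHa] lta; first by exists (fun=> 0); rewrite ?big1.
have [c ca cg] := IHa (ltnW lta).
have [j ltj] : exists j, c j < g j.
  apply/existsP; apply: contraTT lta; rewrite negb_exists => /forallP gc.
  by rewrite -leqNgt -ca leq_sum // => j _; rewrite leqNgt gc.
exists (fun i => c i + (i == j)) => [|i].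
  by rewrite big_split /= ca (bigD1 j) //= eqxx big1 ?addn1 // => i /negPf->.
by case: eqP => [->|_]; rewrite ?addn1 ?addn0.
Qed.

Hypotheses (nDp : n * D - n < p) (pD : ~~ (p %| D)).

(* Past the first s with D < \sum_j res s j some coordinate has room to spare,
   and can then carry the largest possible digit p - 1 at all later places. *)
Lemma nocarry_max s e :
  (forall e', e' < s -> \sum_j res e' j <= D) -> D < \sum_j res s j -> s <= e ->
  exists2 v, nocarry p ((\sum_j trunc s j).+1 * p ^ (e - s)).-1 v &
             forall j, D * v j < p ^ e * w j.
Proof.
move=> small large; have trunc_s := nocarry_trunc small.
(* The bound [res_ltD] used in the main case fails if w_j = D; there the coordinate j0 alone
   provides p^e - 1. *)
have [[j0 wj0]|w_neqD] := pselect (exists j, w j = D).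
  (* If s > 0, then the w_j add up to at most D, so j0 is the only coordinate; with n = 1 no residue
     sum exceeds D. *)
  have s0 : s = 0.
    case: s small large {trunc_s} => // s small large.
    have := small 0 (ltn0Sn _); have := sum_trunc_res 0.
    rewrite sum_trunc0 muln0 mul1n add0n => <-; rewrite (bigD1 j0) //= wj0.
    rewrite -{2}[D]addn0 leq_add2l leqn0 sum_nat_eq0 => /forallP w0.
    have one j : j = j0.
      apply/eqP/negP => /negP/(implyP (w0 j))/eqP wj.
      by have := wD j; rewrite wj.
    have n1 : n <= 1.
      rewrite -[n]card_ord -(cards1 j0); apply: subset_leq_card.
      by apply/fintype.subsetP => j _; rewrite inE (one j).
    by case/andP: (sum_res_bounds s.+1); nia.
  move=> _; rewrite s0 subn0; exists (fun j => (p ^ e).-1 * (j == j0)) => [i|j].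
    rewrite sum_trunc0 mul1n (bigD1 j0) //= eqxx muln1 big1 ?addn0 // => j.
    by move/negPf->; rewrite muln0 div0n.
  have q_gt0 : 0 < p ^ e by rewrite expn_gt0 p_gt0.
  case: eqP => [->|_]; last by rewrite !muln0 muln_gt0 q_gt0; case/andP: (wD j).
  by rewrite muln1 wj0 mulnC ltn_pmul2r // prednK.
(* A residue D means that D divides p^e' w_j, hence w_j because p is prime to D, which forces w_j =
   D. *)
have res_ltD e' j : res e' j < D.
  have /andP[_] := lpr_bounds (p ^ e' * w j); rewrite leq_eqVlt => /orP[/eqP|//].
  move=> eqD; case: w_neqD; exists j.
  have : D %| w j.
    have copDp : coprime D (p ^ e').
      by rewrite coprime_sym coprimeXl // prime_coprime.
    rewrite -(Gauss_dvdr _ copDp).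
    by move: eqD; rewrite /lpr; case: ifP => // _ modD;
       have := ltn_pmod (p ^ e' * w j) D_gt0; rewrite modD ltnn.
  have /andP[w_gt0 w_leD] := wD j; move/(dvdn_leq w_gt0) => Dw.
  by apply/eqP; rewrite eqn_leq w_leD.
(* Here p > nD - n enters: D times the digit sum is at least p (D + 1) - (nD - n) > p D. *)
have sum_digit_gt : p <= \sum_j digit s j.
  have : \sum_j res s.+1 j <= n * D - n.
    have -> : n * D - n = \sum_(j < n) D.-1.
      by rewrite sum_nat_const card_ord -subn1 mulnBr muln1.
    by apply: leq_sum => j _; rewrite -ltnS prednK.
  have := sum_digit s; set x := \sum_j digit s j; nia.
rewrite leq_eqVlt => /orP[/eqP<-|].
  rewrite subnn muln1; exists (trunc s) => // j.
  by rewrite ltn_trunc.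
have p_gt1 := prime_gt1 p_prime; set m := \sum_j trunc s j.
(* The last condition is the room to spare at j. It persists when the digit p - 1 is appended at j
   and 0 elsewhere, since p v_j + (p - 1) + 1 = p (v_j + 1). *)
suff step t : exists v j, [/\ nocarry p (m.+1 * p ^ t.+1).-1 v,
    forall i, D * v i < p ^ (s + t.+1) * w i &
    D * (v j).+1 < p ^ (s + t.+1) * w j].
  move=> lt_se; have := step (e - s.+1).
  rewrite -subSn // subSS subnKC ?(ltnW lt_se) //.
  by move=> [v [j [mv ltv _]]]; exists v.
elim: t => [|t [v [j [mv ltv ltj]]]].
  (* At place s + 1 the digits are lowered to total p - 1; as they added up to at least p, one of
     them strictly drops. *)
  have [c sumc cg] := sum_lower_bound (leq_trans (leq_pred p) sum_digit_gt).
  have [j ltj] : exists j, c j < digit s j.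
    apply/existsP; apply: contraTT sum_digit_gt; rewrite negb_exists => /forallP gc.
    rewrite -ltnNge -[ltnRHS]prednK // ltnS -sumc leq_sum // => j _.
    by rewrite leqNgt gc.
  exists (fun j => p * trunc s j + c j), j; split.
  - rewrite expn1 (_ : _.-1 = p * m + \sum_j c j); last by rewrite sumc; nia.
    by apply: nocarry_cons; rewrite ?sumc ?prednK.
  - by move=> i; rewrite addn1 ltn_trunc digitE leq_add2l.
  - by rewrite addn1 ltn_trunc digitE -addnS leq_add2l.
exists (fun i => p * v i + p.-1 * (i == j)), j; split.
- have sumc : \sum_i p.-1 * (i == j) = p.-1.
    by rewrite (bigD1 j) //= eqxx muln1 big1 ?addn0 // => i /negPf->; rewrite muln0.
  rewrite (_ : _.-1 = p * (m.+1 * p ^ t.+1).-1 + \sum_i p.-1 * (i == j)).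
    by apply: nocarry_cons; rewrite ?sumc ?prednK.
  have : 0 < m.+1 * p ^ t.+1 by rewrite muln_gt0 expn_gt0 p_gt0.
  rewrite sumc [p ^ t.+2]expnS mulnCA; set x := m.+1 * _; nia.
- move=> i; rewrite addnS expnS -mulnA; case: eqP => [->|_]; last first.
    by rewrite muln0 addn0 mulnCA ltn_pmul2l.
  apply: leq_trans (_ : p * (D * (v j).+1) <= _); last first.
    by rewrite leq_mul2l ltnW ?orbT.
  by rewrite muln1; nia.
- rewrite addnS expnS -mulnA eqxx muln1 -addnS prednK // -mulnSr mulnCA.
  by rewrite ltn_pmul2l.
Qed.

End TruncatedExpansions.

(** * Passage to the limit and the critical exponent *)

(** Dividing the bound by p^e leaves an error of at most K / p^e, so the sequence converges and
    [limn] is its true limit. *)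
Lemma limn_div_expn (R : realType) (p s : nat) (a : nat -> nat) (c K : R) :
  (1 < p)%N ->
  (forall e, (s <= e)%N -> `|c * (p ^ e)%N%:R - (a e)%:R| <= K) ->
  limn (fun e => (a e)%:R / (p ^ e)%N%:R : R) = c.
Proof.
move=> p_gt1 bound; apply: cvg_lim => //.
have pVlt1 : `|p%:R^-1 : R| < 1.
  by rewrite ger0_norm ?invr_ge0 // invf_lt1 ?ltr1n // ltr0n ltnW.
have errn0 : ((fun e => K * p%:R^-1 ^+ e : R) @ \oo --> (0 : R))%classic.
  by rewrite -(mulr0 K); apply: cvgMr; apply: cvg_expr.
apply/cvgrPdist_le => eps eps_gt0.
have [N _ small] := cvgr_dist_le _ _ errn0 _ eps_gt0.
exists (maxn N s) => // e /=; rewrite geq_max => /andP[leNe lese].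
apply: le_trans (small _ leNe).
have q_gt0 : (0 : R) < (p ^ e)%N%:R by rewrite ltr0n expn_gt0 ltnW.
rewrite sub0r normrN exprVn -natrX ler_normr; apply/orP; left.
rewrite ler_pdivlMr // -[X in _ * X]gtr0_norm // -normrM mulrBl divfK ?gt_eqF //.
exact: bound.
Qed.

(** Multiplying by lcm / d_j gives all fractions u_j / d_j the same denominator. *)
Lemma lt_lcm_coords (n : nat) (d u : 'I_n -> nat) (j : 'I_n) (x q : nat) :
  (0 < lcm_coords d)%N ->
  (d j * x < q * u j)%N = (lcm_coords d * x < q * bar d u j)%N.
Proof.
have /dvdnP[g lcmE] : (d j %| lcm_coords d)%N by apply: biglcmn_sup.
rewrite /bar lcmE muln_gt0 => /andP[g_gt0 d_gt0].
by rewrite [(_ * _ * u j)%N]mulnAC mulnK // mulnCA -mulnA ltn_pmul2l.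
Qed.

Theorem theorem5p5 (R : realType) (p : nat) (k : fieldType) (n : nat)
    (d u : 'I_n -> nat)
    (hp : p \in [pchar k]) (hk : F_finite p k) (hn : (1 <= n)%N)
    (hd : forall i, (0 < d i)%N)
    (hpn : (n * lcm_coords d - n < p)%N) (hpd : ~~ (p %| lcm_coords d)%N)
    (hu : forall i, (0 < u i <= d i)%N) :
  let D := lcm_coords d in
  let c : R := crit R p (diag_ideal k d) (diag_ideal k u) in
  ((D < wdeg d u)%N -> c = 1) /\
  ((wdeg d u <= D)%N ->
    (forall s : nat,
       (1 <= s)%N -> (D < norm_res p d u s)%N ->
       (forall e : nat, (1 <= e)%N -> (D < norm_res p d u e)%N -> (s <= e)%N) ->
       c = (wdeg d u)%:R / D%:R
           - ((norm_res p d u s)%:R - D%:R) / (D%:R * (p ^ s)%N%:R)) /\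
    ((forall e : nat, (1 <= e)%N -> ~ (D < norm_res p d u e)%N) ->
       c = (wdeg d u)%:R / D%:R)).
Proof.
move=> D c.
have p_prime := pcharf_prime hp.
have p_gt1 := prime_gt1 p_prime; have p_gt0 := ltnW p_gt1.
have D_gt0 : (0 < D)%N.
  by rewrite lt0n; apply: contra hpd => /eqP; rewrite -/D => ->; apply: dvdn0.
have wD j : (0 < bar d u j <= D)%N.
  have /dvdnP[g lcmE] : (d j %| D)%N by apply: biglcmn_sup.
  have g_gt0 : (0 < g)%N by move: D_gt0; rewrite lcmE muln_gt0 => /andP[].
  have /andP[u_gt0 u_led] := hu j.
  by rewrite /bar -/D lcmE mulnAC mulnK // muln_gt0 g_gt0 u_gt0 leq_mul2l u_led orbT.
pose T e := (\sum_j trunc p D (bar d u) e j)%N.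
have T_res e : (p ^ e * wdeg d u = D * T e + norm_res p d u e)%N.
  exact: sum_trunc_res.
have normres0 : norm_res p d u 0 = wdeg d u.
  by have := T_res 0%N; rewrite /T (sum_trunc0 _ wD) muln0 mul1n => ->.
have DR0 : (D%:R : R) != 0 by rewrite pnatr_eq0 -lt0n.
have qR0 e : ((p ^ e)%N%:R : R) != 0 by rewrite pnatr_eq0 -lt0n expn_gt0 ltnW.
have normresE e :
    (norm_res p d u e)%:R = (p ^ e)%N%:R * (wdeg d u)%:R - D%:R * (T e)%:R :> R.
  by rewrite -!natrM T_res natrD addrC addKr.
(* For e >= s, mu is (T s + 1) p^(e-s) - 1, at distance 1 from p^e times the claimed limit. Taking s
   = 0, where T 0 = 0, gives the value 1. *)
have overflow s : (forall e, (e < s)%N -> (norm_res p d u e <= D)%N) ->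
    (D < norm_res p d u s)%N -> c = (T s).+1%:R / (p ^ s)%N%:R.
  move=> small large; apply: (limn_div_expn (s := s) (K := 1)) => // e le_se.
  have [v mv ltv] := nocarry_max p_prime hn D_gt0 wD hpn hpd small large le_se.
  have ltv' j : (d j * v j < p ^ e * u j)%N by rewrite lt_lcm_coords.
  have pos : (0 < (T s).+1 * p ^ (e - s))%N by rewrite muln_gt0 expn_gt0 p_gt0.
  rewrite (mu_diag hp mv ltv') => [|m' v' mv' ltv''].
    have -> : (p ^ e)%N%:R = (p ^ s)%N%:R * (p ^ (e - s))%N%:R :> R.
      by rewrite -natrM -expnD subnKC.
    by rewrite -subn1 natrB // natrM mulrA divfK // opprB addrCA subrr addr0 normr1.
  rewrite -ltnS prednK //; apply: nocarry_bound mv' _ => // j.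
  by rewrite -lt_lcm_coords.
split=> [large|small0].
  rewrite (overflow 0%N) // ?normres0 //.
  by rewrite /T (sum_trunc0 _ wD) expn0 divr1.
split=> [s s_gt0 large min_s|small].
  rewrite (overflow s) // => [|e lt_es].
    by rewrite normresE -natr1; field; rewrite DR0 qR0.
  case: e lt_es => [|e] lt_es; first by rewrite normres0.
  rewrite leqNgt; apply/negP => /min_s-/(_ isT); by rewrite leqNgt lt_es.
have small' e : (norm_res p d u e <= D)%N.
  case: e => [|e]; first by rewrite normres0.
  by rewrite leqNgt; apply/negP/small.
(* No place overflows, so mu is [T e]; the error p^e deg(u) / D - T e is the residue sum divided by
   D, which lies between 0 and 1. *)
apply: (limn_div_expn (s := 0) (K := 1)) => // e _.
have mT := nocarry_trunc p_prime hn D_gt0 wD (fun e' (_ : (e' < e)%N) => small' e').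
have ltT j : (d j * trunc p D (bar d u) e j < p ^ e * u j)%N.
  by rewrite lt_lcm_coords // (ltn_trunc p_prime D_gt0 wD).
rewrite (mu_diag hp mT ltT) => [|m' v' mv' ltv']; last first.
  rewrite (nocarry_sum mv'); apply: leq_sum => j _.
  by rewrite -(ltn_trunc p_prime D_gt0 wD) -lt_lcm_coords.
rewrite -/(T e) (_ : _ - _ = (norm_res p d u e)%:R / D%:R); last first.
  by rewrite normresE; field.
rewrite ger0_norm ?mulr_ge0 ?invr_ge0 // ler_pdivrMr ?ltr0n //.
by rewrite mul1r ler_nat.
Qed.
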